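(* Given an arbitrary finite set of primes $\mathcal{P}$, there exist a positive integer $n$ and a pair of transitive $S_n$-sets $X$ and $Y$ such that, for every field $k$, $k[X]\cong k[Y]$ as $kS_n$-modules if and only if $\operatorname{char} k\notin\mathcal{P}$.
   Context: $S_n$ is the symmetric group on $n$ letters. For a finite $S_n$-set $X$, $k[X]$ denotes the permutation module of maps $X\to k$, a module over the group algebra $kS_n$. *)

(* Defs.v *)
From HB Require Import structures.
From mathcomp Require Import all_boot all_order all_algebra all_fingroup.

Set Implicit Arguments.
Unset Strict Implicit.
Unset Printing Implicit Defensive.

Import GRing.Theory.
Local Open Scope ring_scope.

(* Elements of R[gT] are the coefficient functions gT -> R.  The alias is
   needed because {ffun gT -> R} already carries the pointwise product. *)
Definition group_algebra (R : nzRingType) (gT : finGroupType) : Type :=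
  {ffun gT -> R}.

HB.instance Definition _ (R : nzRingType) (gT : finGroupType) :=
  GRing.Zmodule.copy (group_algebra R gT) {ffun gT -> R}.

Section GroupAlgebra.

Variables (R : nzRingType) (gT : finGroupType).
Implicit Types a b c : group_algebra R gT.

Definition ga_one : group_algebra R gT := [ffun g => (g == 1%g)%:R].

Definition ga_mul a b : group_algebra R gT :=
  [ffun g => \sum_(h : gT) a h * b (h^-1 * g)%g].

Lemma ga_mulA : associative ga_mul.
Proof.
move=> a b c; apply/ffunP=> g; rewrite !ffunE.
under eq_bigr do rewrite ffunE mulr_sumr.
under [RHS]eq_bigr do rewrite ffunE mulr_suml.
rewrite [RHS]exchange_big /=; apply: eq_bigr => h _.
rewrite (reindex_inj (mulgI h^-1%g)) /=; apply: eq_bigr => u _.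
by rewrite mulrA invMg invgK -!mulgA mulKVg.
Qed.

Lemma ga_mul1 : left_id ga_one ga_mul.
Proof.
move=> a; apply/ffunP=> g; rewrite ffunE (bigD1 1%g) //= big1 => [|h /negPf hN1].
  by rewrite ffunE eqxx mul1r addr0 invg1 mul1g.
by rewrite ffunE hN1 mul0r.
Qed.

Lemma ga_mulr1 : right_id ga_one ga_mul.
Proof.
move=> a; apply/ffunP=> g; rewrite ffunE (bigD1 g) //= big1 => [|h hNg].
  by rewrite ffunE mulVg eqxx mulr1 addr0.
by rewrite ffunE -eq_mulVg1 (negPf hNg) mulr0.
Qed.

Lemma ga_mulDl : left_distributive ga_mul +%R.
Proof.
move=> a b c; apply/ffunP=> g; rewrite !ffunE -big_split /=.
by apply: eq_bigr => h _; rewrite ffunE mulrDl.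
Qed.

Lemma ga_mulDr : right_distributive ga_mul +%R.
Proof.
move=> a b c; apply/ffunP=> g; rewrite !ffunE -big_split /=.
by apply: eq_bigr => h _; rewrite ffunE mulrDr.
Qed.

Lemma ga_one_neq0 : ga_one != 0.
Proof.
apply/eqP=> /ffunP/(_ 1%g); rewrite !ffunE eqxx; exact/eqP/oner_neq0.
Qed.

HB.instance Definition _ := GRing.Zmodule_isNzRing.Build (group_algebra R gT)
  ga_mulA ga_mul1 ga_mulr1 ga_mulDl ga_mulDr ga_one_neq0.

End GroupAlgebra.

(* R[X] for the gT-set given by the action to on X. *)
Definition perm_module (R : nzRingType) (gT : finGroupType) (X : finType)
  (to : {action gT &-> X}) : Type := {ffun X -> R}.

HB.instance Definition _ (R : nzRingType) (gT : finGroupType) (X : finType)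
    (to : {action gT &-> X}) :=
  GRing.Zmodule.copy (perm_module R to) {ffun X -> R}.

Section PermModule.

Variables (R : nzRingType) (gT : finGroupType) (X : finType).
Variable to : {action gT &-> X}.
Implicit Types (a b : group_algebra R gT) (phi : perm_module R to).

(* Library actions are on the right: to x g is the point x g, to be thought of
   as g^-1 x for a left gT-set.  Hence the usual (g phi)(x) = phi (g^-1 x)
   reads (g phi)(x) = phi (x g), which is a left module structure. *)
Definition pm_scale a phi : perm_module R to :=
  [ffun x => \sum_(g : gT) a g * phi (to x g)].

Lemma pm_scaleA a b phi : pm_scale a (pm_scale b phi) = pm_scale (a * b) phi.
Proof.
apply/ffunP=> x; rewrite !ffunE.
under eq_bigr do rewrite ffunE mulr_sumr.
under [RHS]eq_bigr do rewrite ffunE mulr_suml.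
rewrite [RHS]exchange_big /=; apply: eq_bigr => h _.
rewrite [RHS](reindex_inj (mulgI h)) /=; apply: eq_bigr => u _.
by rewrite mulKg mulrA actM.
Qed.

Lemma pm_scale1 : left_id 1 pm_scale.
Proof.
move=> phi; apply/ffunP=> x.
rewrite ffunE (bigD1 1%g) //= big1 => [|h /negPf hN1].
  by rewrite ffunE eqxx mul1r addr0 act1.
by rewrite ffunE hN1 mul0r.
Qed.

Lemma pm_scaleDr : right_distributive pm_scale +%R.
Proof.
move=> a phi psi; apply/ffunP=> x; rewrite !ffunE -big_split /=.
by apply: eq_bigr => g _; rewrite ffunE mulrDr.
Qed.

Lemma pm_scaleDl phi : {morph pm_scale^~ phi : a b / a + b}.
Proof.
move=> a b; apply/ffunP=> x; rewrite !ffunE -big_split /=.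
by apply: eq_bigr => g _; rewrite ffunE mulrDl.
Qed.

HB.instance Definition _ :=
  GRing.Zmodule_isLmodule.Build (group_algebra R gT) (perm_module R to)
    pm_scaleA pm_scale1 pm_scaleDr pm_scaleDl.

End PermModule.

Definition module_isomorphic (A : nzRingType) (U V : lmodType A) : Prop :=
  exists f : {linear U -> V}, bijective f.

(* Main.v *)
Require Import Defs.
From HB Require Import structures.
From mathcomp Require Import all_boot all_order all_algebra all_fingroup all_solvable.

Set Implicit Arguments.
Unset Strict Implicit.
Unset Printing Implicit Defensive.

Import GRing.Theory.
Local Open Scope ring_scope.

(* If an integer matrix X -> Y commuting with G has an equivariant inverse up to
   the integer m, then k[X] and k[Y] are isomorphic whenever m is nonzero in k.
   Conversely, in characteristic p an equivariant invertible matrix restricts to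
   an invertible matrix on the fixed points of any p-subgroup Q, because nontrivial
   Q-orbits contribute multiples of p to the matrix product; hence an isomorphism
   forces |X^Q| = |Y^Q|.

   For one prime p, let G = GL_3(F_p), X the nonzero rows and Y the nonzero rows
   with the contragredient action.  With u.v the dot product, the matrix
   [u.v = 1] has inverse [u.v = 1] - [u.v = 0] up to p^2: for independent v, w a
   translation exchanges {u : u.v = 1, u.w = 1} and {u : u.v = 1, u.w = 0}.  The
   group Q of matrices 1 + e_0^T f with f e_0^T = 0 fixes p^2 - 1 points of X and
   p - 1 points of Y.  Products of such triples (G, X, Y) treat several primes.

   To replace G by a symmetric group, let G act on a disjoint union W of |Y| + 1
   copies of X and one copy of Y, and induce X and Y from G to Sym(W).  Fixed points of
   Q on the induced sets are counted by the Sym(W)-conjugates of Q lying in G; each of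
   them has |W^Q| fixed points on W, and the multiplicities in W are such that |W^Q|
   determines both |X^Q| and |Y^Q|. *)

(** * Matrices between permutation modules *)

Section Matrices.

Variables (gT : finGroupType) (X Y : finType).
Variables (toX : {action gT &-> X}) (toY : {action gT &-> Y}).

Definition equivariant (T : Type) (M : X -> Y -> T) :=
  forall g x y, M (toX x g) (toY y g) = M x y.

End Matrices.

Definition inverse_upto (R : nzRingType) (X Y : finType) (m : nat)
    (M : X -> Y -> R) (N : Y -> X -> R) :=
  forall x x', \sum_y M x y * N y x' = m%:R *+ (x == x').

(** The matrices are integral so that one pair serves all fields at once: wherever [m] is
    invertible, [M] and [N] divided by [m] become mutually inverse. *)
Definition quasi_isomorphic (gT : finGroupType) (X Y : finType)
    (toX : {action gT &-> X}) (toY : {action gT &-> Y}) (m : nat) :=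
  exists (M : X -> Y -> int) (N : Y -> X -> int),
    [/\ equivariant toX toY M, equivariant toY toX N,
        inverse_upto m M N & inverse_upto m N M].

Section MatrixMap.

Variables (k : fieldType) (gT : finGroupType) (X Y : finType).
Variables (toX : {action gT &-> X}) (toY : {action gT &-> Y}).

Definition matrix_map (M : X -> Y -> k) (phi : perm_module k toX) :
    perm_module k toY :=
  [ffun y => \sum_x M x y * phi x].

Lemma matrix_map_linear (M : X -> Y -> k) :
  equivariant toX toY M -> linear (matrix_map M).
Proof.
move=> eqM a phi psi; apply/ffunP=> y; rewrite !ffunE.
under eq_bigr do rewrite !ffunE mulrDr.
rewrite big_split /=; congr (_ + _).
under eq_bigr do rewrite mulr_sumr.
rewrite exchange_big /=; apply: eq_bigr => g _.
rewrite ffunE mulr_sumr [RHS](reindex_inj (act_inj toX g)) /=.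
by apply: eq_bigr => x _; rewrite eqM mulrCA.
Qed.

End MatrixMap.

Lemma matrix_mapK (k : fieldType) (gT : finGroupType) (X Y : finType)
    (toX : {action gT &-> X}) (toY : {action gT &-> Y})
    (M : X -> Y -> k) (N : Y -> X -> k) :
  inverse_upto 1 N M ->
  cancel (@matrix_map k gT Y X toY toX N) (@matrix_map k gT X Y toX toY M).
Proof.
move=> NM psi; apply/ffunP=> y; rewrite ffunE.
under eq_bigr do rewrite ffunE mulr_sumr.
rewrite exchange_big /= (bigD1 y) //= [X in _ + X]big1 ?addr0 => [|y' /negPf neq].
  under eq_bigr do rewrite mulrA [M _ _ * _]mulrC.
  by rewrite -mulr_suml NM eqxx mul1r.
under eq_bigr do rewrite mulrA [M _ _ * _]mulrC.
by rewrite -mulr_suml NM neq mul0r.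
Qed.

Lemma quasi_iso_module_iso (k : fieldType) (gT : finGroupType) (X Y : finType)
    (toX : {action gT &-> X}) (toY : {action gT &-> Y}) (m : nat) :
  m%:R != 0 :> k -> quasi_isomorphic toX toY m ->
  module_isomorphic (perm_module k toX) (perm_module k toY).
Proof.
move=> m_neq0 [M [N [eqM eqN MN NM]]].
pose Mk x y : k := (M x y)%:~R; pose Nk y x : k := m%:R^-1 * (N y x)%:~R.
have eqMk : equivariant toX toY Mk by move=> g x y; rewrite /Mk eqM.
have MNk : inverse_upto 1 Mk Nk.
  move=> x x'; under eq_bigr do rewrite mulrCA -intrM.
  rewrite -mulr_sumr -rmorph_sum /= MN rmorphMn /= rmorph_nat.
  by case: eqP => _; rewrite ?mulr1n ?mulVf ?mulr0n ?mulr0.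
have NMk : inverse_upto 1 Nk Mk.
  move=> y y'; under eq_bigr do rewrite -mulrA -intrM.
  rewrite -mulr_sumr -rmorph_sum /= NM rmorphMn /= rmorph_nat.
  by case: eqP => _; rewrite ?mulr1n ?mulVf ?mulr0n ?mulr0.
pose f := @matrix_map k gT X Y toX toY Mk.
pose fL := GRing.isLinear.Build (group_algebra k gT) (perm_module k toX)
  (perm_module k toY) _ f (matrix_map_linear eqMk).
pose fl : {linear perm_module k toX -> perm_module k toY} := HB.pack f fL.
exists fl; exists (@matrix_map k gT Y X toY toX Nk); exact: matrix_mapK.
Qed.

(** The other points fall into [Q]-orbits whose size is a positive power of [p]; [h] is constant on
    each, so each contributes zero in [k]. *)
Lemma sum_invariant_fix (k : fieldType) (gT : finGroupType) (Y : finType)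
    (toY : {action gT &-> Y}) (p : nat) (Q : {group gT}) (h : Y -> k) :
  p \in [pchar k] -> (p.-group Q)%g ->
  (forall q y, q \in Q -> h (toY y q) = h y) ->
  \sum_y h y = \sum_(y in ('Fix_toY(Q))%g) h y.
Proof.
move=> pchark pQ hQ.
rewrite (bigID [in ('Fix_toY(Q))%g]) /= -[RHS]addr0; congr (_ + _).
(* The index [O] runs over all subsets of [Y]; one that is not the orbit of a non-fixed point
   indexes an empty sum. *)
rewrite (partition_big (fun y => orbit toY Q y) predT) //= big1 // => O _.
have [y /andP[nfix_y /eqP <-]|] :=
    pickP [pred y | (y \notin ('Fix_toY(Q))%g) && (orbit toY Q y == O)];
  last by move=> none; rewrite big_pred0.
rewrite (eq_bigr (fun _ => h y)) => [|z /andP[_ /eqP orb_z]]; last first.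
  have /orbitP[q Qq <-] : z \in orbit toY Q y by rewrite -orb_z orbit_refl.
  exact: hQ.
rewrite big_const iter_addr_0 -mulr_natr.
suff /eqP-> : #|[pred z | (z \notin ('Fix_toY(Q))%g) &&
                  (orbit toY Q z == orbit toY Q y)]|%:R == 0 :> k by rewrite mulr0.
rewrite -(dvdn_pcharf pchark) (@eq_card _ _ (mem (orbit toY Q y))) => [|z].
  have [e orb_card] := p_natP (pnat_dvd (dvdn_orbit toY Q y) pQ).
  rewrite orb_card; case: e orb_card => [/card_orbit1/orbit1P|e _].
    by rewrite (negPf nfix_y).
  exact: dvdn_exp.
rewrite unfold_in /= orbit_eq_mem andb_idl // => zy; apply: contra nfix_y.
by move/orbit1P=> orb_z; move: zy; rewrite orbit_sym orb_z => /set1P->; apply/orbit1P.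
Qed.

(** * The matrix of a module homomorphism and its restriction to fixed points *)

Section HomMatrix.

Variables (k : fieldType) (gT : finGroupType) (X Y : finType).
Variables (toX : {action gT &-> X}) (toY : {action gT &-> Y}).
Variable f : {linear perm_module k toX -> perm_module k toY}.

Definition delta_fun (x : X) : perm_module k toX := [ffun z => (z == x)%:R].

Definition hom_matrix (x : X) (y : Y) : k := f (delta_fun x) y.

(** The element c g of the group algebra. Taking g = 1 embeds [k], so that linearity over the group
    algebra yields linearity over [k]. *)
Definition ga_scaled (c : k) (g : gT) : group_algebra k gT := [ffun h => c *+ (h == g)].

Lemma ga_scaledE (c : k) (g : gT) (Z : finType) (toZ : {action gT &-> Z})
    (phi : perm_module k toZ) (z : Z) :
  (ga_scaled c g *: phi) z = c * phi (toZ z g).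
Proof.
rewrite ffunE (bigD1 g) //= ffunE eqxx big1 ?addr0 // => h /negPf neq.
by rewrite ffunE neq mul0r.
Qed.

Lemma hom_matrixE (phi : perm_module k toX) (y : Y) :
  f phi y = \sum_x phi x * hom_matrix x y.
Proof.
have {1}-> : phi = \sum_x ga_scaled (phi x) 1%g *: delta_fun x.
  apply/ffunP=> z; rewrite sum_ffunE (bigD1 z) //= ga_scaledE act1 ffunE eqxx.
  rewrite mulr1 big1 ?addr0 // => x neq.
  by rewrite ga_scaledE act1 ffunE eq_sym (negPf neq) mulr0.
rewrite linear_sum sum_ffunE; apply: eq_bigr => x _.
by rewrite linearZ ga_scaledE act1.
Qed.

Lemma hom_matrix_equivariant : equivariant toX toY hom_matrix.
Proof.
move=> g x y; rewrite /hom_matrix -[RHS]mul1r.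
(* Since g sends a function phi to z -> phi (z g), it carries the delta function at x g to the one
   at x. *)
have -> : delta_fun x = ga_scaled 1 g *: delta_fun (toX x g).
  apply/ffunP=> z; rewrite ga_scaledE !ffunE mul1r.
  by rewrite (inj_eq (act_inj toX g)).
by rewrite linearZ ga_scaledE !mul1r.
Qed.

End HomMatrix.

(** For fixed points x and x', the terms of the (x, x') entry of the product of the two matrices are
    [Q]-invariant in y, so only fixed y count. The restricted matrices therefore still multiply to
    the identity, and comparing ranks gives the bound. *)
Lemma module_iso_card_fix_le (k : fieldType) (gT : finGroupType) (X Y : finType)
    (toX : {action gT &-> X}) (toY : {action gT &-> Y}) (p : nat)
    (Q : {group gT}) (f : {linear perm_module k toX -> perm_module k toY})
    (g : {linear perm_module k toY -> perm_module k toX}) :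
  cancel f g -> p \in [pchar k] -> (p.-group Q)%g ->
  (#|('Fix_toX(Q))%g| <= #|('Fix_toY(Q))%g|)%N.
Proof.
move=> fK pchark pQ.
set FX := ('Fix_toX(Q))%g; set FY := ('Fix_toY(Q))%g.
pose A : 'M[k]_(#|FX|, #|FY|) :=
  \matrix_(i, j) hom_matrix f (enum_val i) (enum_val j).
pose B : 'M[k]_(#|FY|, #|FX|) :=
  \matrix_(j, i) hom_matrix g (enum_val j) (enum_val i).
have AB1 : A *m B = 1%:M.
  apply/matrixP=> i j; rewrite !mxE.
  have <- : delta_fun k toX (enum_val i) (enum_val j) = (i == j)%:R :> k.
    by rewrite ffunE (inj_eq enum_val_inj) eq_sym.
  rewrite -[delta_fun _ _ _]fK hom_matrixE.
  rewrite (sum_invariant_fix (toY := toY) pchark pQ) => [|q y Qq]; last first.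
    have /afixP/(_ q Qq) fix_i := enum_valP i.
    have /afixP/(_ q Qq) fix_j := enum_valP j.
    congr (_ * _); last by rewrite -{1}fix_j hom_matrix_equivariant.
    by rewrite -[LHS]/(hom_matrix f _ _) -{1}fix_i hom_matrix_equivariant.
  rewrite [RHS]big_enum_val /=; apply: eq_bigr => l _.
  by rewrite !mxE.
rewrite -[X in (X <= _)%N](mxrank1 k) -AB1.
exact: leq_trans (mxrankM_maxl _ _) (rank_leq_col _).
Qed.

Lemma module_iso_card_fix (k : fieldType) (gT : finGroupType) (X Y : finType)
    (toX : {action gT &-> X}) (toY : {action gT &-> Y}) (p : nat)
    (Q : {group gT}) :
  module_isomorphic (perm_module k toX) (perm_module k toY) ->
  p \in [pchar k] -> (p.-group Q)%g ->
  #|('Fix_toX(Q))%g| = #|('Fix_toY(Q))%g|.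
Proof.
move=> [f [g fK gK]] pchark pQ.
have g_lin : linear g.
  by move=> a u v; apply: (can_inj fK); rewrite linearP !gK.
pose gL := GRing.isLinear.Build (group_algebra k gT) (perm_module k toY)
  (perm_module k toX) _ g g_lin.
pose gl : {linear perm_module k toY -> perm_module k toX} := HB.pack g gL.
apply/eqP; rewrite eqn_leq.
rewrite (module_iso_card_fix_le (f := f) (g := gl) fK pchark pQ).
exact: (module_iso_card_fix_le (f := gl) (g := f) gK pchark pQ).
Qed.

(** * Actions telling apart the characteristics in P *)

(** [quasi_iso_away] gives isomorphisms in characteristics outside [P], [fixed_points_at] excludes
    them at each p in [P], and [faithful_source] provides the embedding of [gT] into a symmetric
    group. *)
Record distinguishes (P : seq nat) (gT : finGroupType) (X Y : finType)
    (toX : {action gT &-> X}) (toY : {action gT &-> Y}) : Prop := Distinguishes {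
  transitive_source : [transitive [set: gT], on [set: X] | toX];
  transitive_target : [transitive [set: gT], on [set: Y] | toY];
  faithful_source : forall g, (forall x, toX x g = x) -> g = 1%g;
  quasi_iso_away : exists2 m, [pred p in P].-nat m & quasi_isomorphic toX toY m;
  fixed_points_at : forall p, p \in P -> exists2 Q : {group gT},
    (p.-group Q)%g & #|('Fix_toX(Q))%g| != #|('Fix_toY(Q))%g| }.

(** * Nonzero rows and the dual action *)

Section DotProduct.

Variables (F : finFieldType) (n : nat).
Implicit Types u v w t : 'rV[F]_n.

Definition dot u v : F := (u *m v^T) 0 0.

Lemma dotDl u v w : dot (u + v) w = dot u w + dot v w.
Proof. by rewrite /dot mulmxDl mxE. Qed.

Lemma dotZl a u v : dot (a *: u) v = a * dot u v.
Proof. by rewrite /dot -scalemxAl mxE. Qed.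

Lemma dotC u v : dot u v = dot v u.
Proof. by rewrite /dot -[v in LHS]trmxK -[u in LHS]trmxK -trmx_mul !trmxK mxE. Qed.

Lemma dotZr a u v : dot u (a *: v) = a * dot u v.
Proof. by rewrite dotC dotZl dotC. Qed.

Lemma dot0 v : dot 0 v = 0.
Proof. by rewrite /dot mul0mx mxE. Qed.

(** The columns of [cokermx v] cut out the span of [v], so one of them is nonzero on [w]; [t] is
    that column, transposed and rescaled. *)
Lemma dot_separates v w : ~~ (w <= v)%MS -> exists2 t, dot t v = 0 & dot t w = 1.
Proof.
rewrite submxE => /matrix0Pn[i [j neq0]]; rewrite ord1 in neq0.
pose t := (col j (cokermx v))^T.
have dott u : dot t u = (u *m cokermx v) 0 j.
  by rewrite dotC /dot trmxK !mxE; apply: eq_bigr => l _; rewrite mxE.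
exists (((w *m cokermx v) 0 j)^-1 *: t); rewrite dotZl dott.
  by rewrite mulmx_coker [X in _ * X]mxE mulr0.
by rewrite mulVf.
Qed.

Lemma dot_surj v : v != 0 -> exists t, dot t v = 1.
Proof.
move=> v_neq0; have [|t _ tv] := @dot_separates 0 v; last by exists t.
by apply: contra v_neq0 => /sub_rVP[a ->]; rewrite scaler0.
Qed.

(** Translation by multiples of a row [t] with [dot t v = 1] permutes the level sets of [dot^~ v],
    so these #|F| sets have equal size. *)
Lemma card_dot v c : v != 0 -> #|[set u | dot u v == c]| = (#|F| ^ n.-1)%N.
Proof.
move=> v_neq0; have [t tv] := dot_surj v_neq0.
have n_gt0 : (0 < n)%N.
  case: (posnP n) => // n0; case/eqP: v_neq0; apply/rowP => -[j lt_j].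
  by exfalso; rewrite n0 in lt_j.
have shift d : #|[set u | dot u v == d]| = #|[set u | dot u v == c]|.
  rewrite -[RHS](card_imset _ (addIr ((d - c) *: t))).
  apply: eq_card => u; rewrite inE; apply/idP/imsetP => [/eqP uv|[w]].
    exists (u - (d - c) *: t); last by rewrite subrK.
    by rewrite inE dotDl -scaleNr dotZl tv mulr1 uv opprB addrC subrK.
  by rewrite inE => /eqP wv ->; rewrite dotDl dotZl tv mulr1 wv addrC subrK.
have : #|{: 'rV[F]_n}| = (#|F| * #|[set u | dot u v == c]|)%N.
  rewrite -[LHS]sum1_card (partition_big (dot^~ v) predT) //=.
  rewrite (eq_bigr (fun _ => #|[set u | dot u v == c]|)) => [|d _].
    by rewrite sum_nat_const.
  by rewrite -(shift d) -sum1_card; apply: eq_bigl => u; rewrite inE.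
rewrite card_mx mul1n -{1}(prednK n_gt0) expnS => /eqP.
by rewrite eqn_pmul2l => [/eqP//|]; apply/card_gt0P; exists 0.
Qed.

Lemma card_dot_pair v w : ~~ (w <= v)%MS ->
  #|[set u | (dot u v == 1) && (dot u w == 1)]| =
  #|[set u | (dot u v == 1) && (dot u w == 0)]|.
Proof.
move=> /dot_separates[t tv tw]; rewrite -[RHS](card_imset _ (addIr t)).
apply: eq_card => u; rewrite inE; apply/andP/imsetP => [[/eqP uv /eqP uw]|[x]].
  exists (u - t); last by rewrite subrK.
  by rewrite inE !(dotDl, =^~ scaleN1r, dotZl) tv tw uv uw mulr0 addr0 mulr1 subrr !eqxx.
by rewrite inE => /andP[/eqP xv /eqP xw] ->; rewrite !dotDl tv tw xv xw addr0 add0r.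
Qed.

Lemma sum_dot v w : v != 0 -> w != 0 ->
  \sum_(u : 'rV[F]_n) (dot u v == 1)%:R * ((dot u w == 1)%:R - (dot u w == 0)%:R)
    = (#|F| ^ n.-1)%:R *+ (v == w) :> int.
Proof.
move=> v_neq0 w_neq0.
have card_sum (p : pred 'rV[F]_n) : \sum_u (p u)%:R = #|[set u | p u]|%:R :> int.
  rewrite -natr_sum; congr (_%:R).
  by rewrite -sum1dep_card [RHS]big_mkcond; apply: eq_bigr => u _; case: (p u).
under eq_bigr do rewrite mulrBr -!natrM !mulnb.
rewrite sumrB !card_sum.
have [/sub_rVP[a w_eq]|w_indep] := boolP (w <= v)%MS; last first.
  rewrite (card_dot_pair w_indep) subrr; case: eqP w_indep => [->|//].
  by rewrite submx_refl.
(* Where [dot u v = 1], [dot u w] equals [a]. So the second count is zero, while the first is the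
   whole hyperplane if [a = 1] and zero otherwise. *)
have a_neq0 : a != 0 by apply: contraNneq w_neq0 => a0; rewrite w_eq a0 scale0r.
rewrite [X in _ - X%:R](_ : _ = 0%N) ?subr0; last first.
  apply/eqP; rewrite cards_eq0; apply/eqP/setP => u; rewrite !inE w_eq dotZr.
  by case: eqP => //= ->; rewrite mulr1 (negPf a_neq0).
have [v_eq|neq] := eqVneq v w.
  rewrite -v_eq -(card_dot 1 v_neq0).
  by congr (_%:R); apply: eq_card => u; rewrite !inE andbb.
rewrite [X in X%:R = _](_ : _ = 0%N) //.
apply/eqP; rewrite cards_eq0; apply/eqP/setP => u; rewrite !inE w_eq dotZr.
case: eqP => //= ->; rewrite mulr1; apply/negbTE; apply: contra neq => /eqP a1.
by rewrite w_eq a1 scale1r.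
Qed.

End DotProduct.

(** In the rank decomposition of [v], the left factor is a nonzero scalar [c] because [v] has a
    single row, and the middle factor is the first basis row; [c] is absorbed into the right
    factor. *)
Lemma row_transitive (F : fieldType) (n : nat) (v : 'rV[F]_n.+1) :
  v != 0 -> exists2 A, A \in unitmx & delta_mx 0 0 *m A = v.
Proof.
move=> v_neq0; pose c := col_ebase v 0 0.
have c_unit : c != 0.
  have := col_ebase_unit v.
  by rewrite unitmxE det_mx11 unitfE.
exists (c *: row_ebase v); first by rewrite unitmxZ ?row_ebase_unit ?unitfE.
rewrite -[RHS]mulmx_ebase rank_rV v_neq0 -scalemxAr scalemxAl; congr (_ *m _).
apply/rowP => j; rewrite !mxE big_ord1 !mxE /c.
by rewrite eq_sym; case: j => [[|j] lt_j].
Qed.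

Section NonzeroRows.

Variable F : finFieldType.

Definition nzrow : Type := {v : 'rV[F]_3 | v != 0}.

HB.instance Definition _ := SubFinite.on nzrow.

Implicit Types (v w : nzrow) (g : {'GL_3[F]}).

Lemma mulmx_unit_neq0 (v : 'rV[F]_3) (A : 'M[F]_3) :
  v != 0 -> A \in unitmx -> v *m A != 0.
Proof. by move=> v_neq0 A_unit; rewrite -(mul0mx 1 A) (can_eq (mulmxK A_unit)). Qed.

Lemma row_act_subproof v g : val v *m GLval g != 0.
Proof. exact: mulmx_unit_neq0 (valP v) (GL_unitmx g). Qed.

Definition row_act v g : nzrow := Sub (val v *m GLval g) (row_act_subproof v g).

Lemma row_act1 : row_act^~ 1%g =1 id.
Proof. by move=> v; apply: val_inj; rewrite /= mulmx1. Qed.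

Lemma row_actM v : act_morph row_act v.
Proof. by move=> g h; apply: val_inj; apply: mulmxA. Qed.

Definition row_action := TotalAction row_act1 row_actM.

Lemma dual_row_act_subproof v g : val v *m (GLval (g^-1))^T != 0.
Proof.
apply: mulmx_unit_neq0 (valP v) _; rewrite unitmx_tr.
exact: (GL_unitmx g^-1).
Qed.

Definition dual_row_act v g : nzrow :=
  Sub (val v *m (GLval (g^-1))^T) (dual_row_act_subproof v g).

Lemma dual_row_actE v g : val (dual_row_act v g) = val v *m (GLval g^-1)^T.
Proof. by []. Qed.

Lemma dual_row_act1 : dual_row_act^~ 1%g =1 id.
Proof.
move=> v; apply: val_inj; rewrite dual_row_actE invg1.
by rewrite -[GLval 1%g]/(1%:M) trmx1 mulmx1.
Qed.

Lemma dual_row_actM v : act_morph dual_row_act v.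
Proof.
move=> g h; apply: val_inj; rewrite !dual_row_actE invMg.
by rewrite -[GLval _]/(GLval h^-1 *m GLval g^-1) trmx_mul mulmxA.
Qed.

Definition dual_row_action := TotalAction dual_row_act1 dual_row_actM.

Lemma delta_row_neq0 : delta_mx 0 0 != 0 :> 'rV[F]_3.
Proof. by apply/eqP=> /matrixP/(_ 0 0)/eqP; rewrite !mxE oner_eq0. Qed.

Definition delta_row : nzrow := Sub (delta_mx 0 0) delta_row_neq0.

Lemma row_action_transitive : [transitive [set: {'GL_3[F]}], on setT | row_action].
Proof.
apply/imsetP; exists delta_row => //; apply/setP=> v; rewrite inE; apply/esym.
have [A A_unit vE] := row_transitive (valP v).
apply/orbitP; exists (FinRing.unit _ A_unit : {'GL_3[F]}) => //.
exact: val_inj.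
Qed.

Lemma dual_row_action_transitive :
  [transitive [set: {'GL_3[F]}], on setT | dual_row_action].
Proof.
apply/imsetP; exists delta_row => //; apply/setP=> v; rewrite inE; apply/esym.
have [A A_unit vE] := row_transitive (valP v).
have AT_unit : A^T \is a GRing.unit by rewrite -[_ \is a _]/(_ \in unitmx) unitmx_tr.
apply/orbitP; exists ((FinRing.unit _ AT_unit : {'GL_3[F]})^-1)%g => //.
apply: val_inj; rewrite -[LHS]/(val (dual_row_act _ _)) dual_row_actE invgK.
by rewrite -[GLval _]/(A^T) trmxK.
Qed.

Lemma row_action_faithful g : (forall v, row_action v g = v) -> g = 1%g.
Proof.
move=> fix_g; apply: val_inj; apply/row_matrixP => i; rewrite !rowE mulmx1.
have ei_neq0 : delta_mx 0 i != 0 :> 'rV[F]_3.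
  by apply/eqP=> /matrixP/(_ 0 i)/eqP; rewrite !mxE !eqxx oner_eq0.
exact: (congr1 val (fix_g (Sub (delta_mx 0 i) ei_neq0))).
Qed.

Definition incidence v w : int := (dot (val v) (val w) == 1)%:R.

Definition signed_incidence v w : int :=
  (dot (val v) (val w) == 1)%:R - (dot (val v) (val w) == 0)%:R.

Lemma dot_invariant v w g : dot (val (row_action v g)) (val (dual_row_action w g))
  = dot (val v) (val w).
Proof.
rewrite -[val (dual_row_action w g)]/(val (dual_row_act w g)) dual_row_actE.
rewrite /dot /= trmx_mul trmxK mulmxA -(mulmxA (val v)).
by rewrite -[X in val v *m X]/(GLval (g * g^-1)) mulgV mulmx1.
Qed.

Lemma incidence_inverse : inverse_upto (#|F| ^ 2) incidence signed_incidence.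
Proof.
(* Extending the sum to the zero row costs nothing: [dot 0 v] is 0, not 1. *)
move=> v w; rewrite -(sum_dot (valP v) (valP w)) (bigD1 0) //= dot0.
rewrite eq_sym oner_eq0 mul0r add0r.
rewrite (big_sub (fun u => u != 0) (fun u => (dot u (val v) == 1)%:R *
  ((dot u (val w) == 1)%:R - (dot u (val w) == 0)%:R))).
by apply: eq_bigr => u _; rewrite /incidence dotC.
Qed.

Lemma inverse_incidence : inverse_upto (#|F| ^ 2) signed_incidence incidence.
Proof.
move=> v w; rewrite eq_sym -incidence_inverse; apply: eq_bigr => u _.
by rewrite mulrC /incidence /signed_incidence !(dotC (val u)).
Qed.

Lemma row_quasi_isomorphic : quasi_isomorphic row_action dual_row_action (#|F| ^ 2).
Proof.
exists incidence, signed_incidence.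
split; [ | | exact: incidence_inverse | exact: inverse_incidence].
  by move=> g v w; rewrite /incidence dot_invariant.
move=> g v w; rewrite /signed_incidence !(dotC (val (dual_row_action _ _))).
by rewrite dot_invariant !(dotC (val w)).
Qed.

(** * Fixed rows of a group of transvections *)

Definition transvection_mx (f : 'rV[F]_2) : 'M[F]_3 := block_mx (1%:M : 'M_1) f 0 1%:M.

Lemma transvection_mx_unit f : transvection_mx f \is a GRing.unit.
Proof.
rewrite -[_ \is a _]/(_ \in unitmx) unitmxE (det_ublock (1%:M : 'M_1)).
by rewrite !det1 mul1r unitr1.
Qed.

Definition transvection f : {'GL_3[F]} := FinRing.unit _ (transvection_mx_unit f).

Lemma transvectionM : {morph transvection : f f' / (f * f')%g}.
Proof.
move=> f f'; apply: val_inj.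
apply: etrans (esym (mulmx_block (1%:M : 'M_1) f 0 1%:M (1%:M : 'M_1) f' 0 1%:M)).
by rewrite !mulmx0 !mul0mx !mul1mx !mulmx1 !add0r !addr0 addrC.
Qed.

Canonical transvection_morphism := @Morphism _ _ [set: 'rV[F]_2] _ (in2W transvectionM).

Definition transvections := (transvection @* [set: 'rV[F]_2])%G.

Lemma transvectionsP g :
  reflect (exists f, g = transvection f) (g \in transvections).
Proof.
apply: (iffP morphimP) => [[f _ _ ->]|[f ->]]; first by exists f.
by exists f; rewrite ?inE.
Qed.

Lemma pgroup_transvections p : p.-nat #|F| -> (p.-group transvections)%g.
Proof.
by move=> pF; apply: morphim_pgroup; rewrite /pgroup cardsT card_mx mul1n pnatX pF.
Qed.

(** Split a row as (a, b) with a of length 1 and b of length 2, as 3 is convertible with 1 + 2. The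
    transvection by f sends it to (a, a f + b), and a f vanishes for all f only if a = 0. *)
Lemma fix_transvections v :
  (v \in ('Fix_row_action(transvections))%g) = (@lsubmx _ 1 1 2 (val v) == 0).
Proof.
have actE f : val (row_action v (transvection f)) =
    row_mx (@lsubmx _ 1 1 2 (val v))
      (@lsubmx _ 1 1 2 (val v) *m f + @rsubmx _ 1 1 2 (val v)).
  rewrite -[LHS]/(val v *m transvection_mx f) -{1}[val v](@hsubmxK _ 1 1 2).
  by rewrite (mul_row_block _ _ (1%:M : 'M_1)) !mulmx1 mulmx0 addr0.
apply/afixP/eqP => [fix_v | l0 g /transvectionsP[f ->]].
  apply/matrixP=> i j; rewrite !ord1 {i j}.
  have T0 := introT (transvectionsP _) (ex_intro _ (delta_mx 0 0) erefl).
  have /(congr1 val) := fix_v _ T0.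
  rewrite actE => /(congr1 (@rsubmx _ 1 1 2)); rewrite row_mxKr => /eqP.
  rewrite -subr_eq0 addrK => /eqP/matrixP/(_ 0 0).
  by rewrite !mxE big_ord1 !mxE !eqxx mulr1.
by apply: val_inj; rewrite actE l0 mul0mx add0r -[in LHS]l0 hsubmxK.
Qed.

(** Dually, the inverse of the transvection by f sends (a, b) to (a + b f^T, b); taking for f the
    basis rows forces b = 0. *)
Lemma fix_dual_transvections v :
  (v \in ('Fix_dual_row_action(transvections))%g) = (@rsubmx _ 1 1 2 (val v) == 0).
Proof.
have actE f : val (dual_row_action v (transvection f)^-1%g) =
    row_mx (@lsubmx _ 1 1 2 (val v) + @rsubmx _ 1 1 2 (val v) *m f^T)
      (@rsubmx _ 1 1 2 (val v)).
  rewrite -[LHS]/(val (dual_row_act _ _)) dual_row_actE invgK.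
  rewrite -[GLval _]/(transvection_mx f) -{1}[val v](@hsubmxK _ 1 1 2).
  rewrite /transvection_mx (tr_block_mx (1%:M : 'M_1)).
  rewrite (mul_row_block _ _ (1%:M^T : 'M_1)).
  by rewrite !trmx1 trmx0 !mulmx1 mulmx0 add0r.
apply/afixP/eqP => [fix_v | r0 g].
  apply/matrixP=> i j; rewrite !ord1 {i}.
  have /groupVr := introT (transvectionsP _) (ex_intro _ (delta_mx 0 j) erefl).
  move=> /fix_v/(congr1 val).
  rewrite actE => /(congr1 (@lsubmx _ 1 1 2)); rewrite row_mxKl => /eqP.
  rewrite addrC -subr_eq0 addrK => /eqP/matrixP/(_ 0 0).
  rewrite !mxE (bigD1 j) //= !mxE !eqxx mulr1 big1 ?addr0 // => l neq.
  by rewrite !mxE (negPf neq) mulr0.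
rewrite -groupV => /transvectionsP[f gV]; rewrite -[g]invgK gV.
by apply: val_inj; rewrite actE r0 mul0mx addr0 -[in LHS]r0 hsubmxK.
Qed.

Lemma card_fix_transvections :
  #|('Fix_row_action(transvections))%g| = (#|F| ^ 2).-1.
Proof.
have rsub_inj : {in ('Fix_row_action(transvections))%g &,
    injective (fun v => @rsubmx _ 1 1 2 (val v))}.
  move=> v w; rewrite !fix_transvections => /eqP lv /eqP lw vw; apply: val_inj.
  by rewrite -[val v](@hsubmxK _ 1 1 2) -[val w](@hsubmxK _ 1 1 2) lv lw vw.
rewrite -(card_in_imset rsub_inj) -[in RHS](mul1n 2%N) -card_mx -(cardsC1 0).
apply: eq_card => b; rewrite !inE; apply/imsetP/idP => [[v]|b_neq0].
  rewrite fix_transvections => /eqP lv ->; apply: contraNneq (valP v) => rv.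
  by rewrite -[val v](@hsubmxK _ 1 1 2) lv rv row_mx0.
have row_neq0 : row_mx (0 : 'M_1) b != 0 by rewrite row_mx_eq0 negb_and b_neq0 orbT.
exists (Sub (row_mx (0 : 'M_1) b) row_neq0); last by rewrite /= row_mxKr.
by rewrite fix_transvections /= row_mxKl.
Qed.

Lemma card_fix_dual_transvections :
  #|('Fix_dual_row_action(transvections))%g| = #|F|.-1.
Proof.
have lsub_inj : {in ('Fix_dual_row_action(transvections))%g &,
    injective (fun v => @lsubmx _ 1 1 2 (val v))}.
  move=> v w; rewrite !fix_dual_transvections => /eqP lv /eqP lw vw; apply: val_inj.
  by rewrite -[val v](@hsubmxK _ 1 1 2) -[val w](@hsubmxK _ 1 1 2) lv lw vw.
rewrite -(card_in_imset lsub_inj) -[in RHS](expn1 #|F|) -[in RHS](mul1n 1%N).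
rewrite -card_mx -(cardsC1 0).
apply: eq_card => b; rewrite !inE; apply/imsetP/idP => [[v]|b_neq0].
  rewrite fix_dual_transvections => /eqP rv ->; apply: contraNneq (valP v) => lv.
  by rewrite -[val v](@hsubmxK _ 1 1 2) lv rv row_mx0.
have row_neq0 : row_mx b (0 : 'rV_2) != 0 by rewrite row_mx_eq0 negb_and b_neq0.
exists (Sub (row_mx b (0 : 'rV_2)) row_neq0); last by rewrite /= row_mxKl.
by rewrite fix_dual_transvections /= row_mxKr.
Qed.

End NonzeroRows.

Lemma distinguishes_nzrow (p : nat) :
  prime p -> distinguishes [:: p] (row_action 'F_p) (dual_row_action 'F_p).
Proof.
move=> p_pr; split.
- exact: row_action_transitive.
- exact: dual_row_action_transitive.
- exact: row_action_faithful.
- exists (#|'F_p| ^ 2)%N; last exact: row_quasi_isomorphic.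
  by rewrite card_Fp // pnatX pnatE // !inE eqxx.
move=> q; rewrite inE => /eqP->; exists (transvections 'F_p).
  by apply: pgroup_transvections; rewrite card_Fp // pnat_id.
rewrite card_fix_transvections card_fix_dual_transvections card_Fp //.
have p_gt1 := prime_gt1 p_pr.
by rewrite -eqSS !prednK ?expn_gt0 ?(ltnW p_gt1) // -[X in _ != X]expn1 eqn_exp2l.
Qed.

(** * Products *)

(* Modulo a prime q > m the permutation modules are isomorphic, so the fixed
   points of the trivial q-group can be compared. *)
Lemma quasi_iso_card (gT : finGroupType) (X Y : finType)
    (toX : {action gT &-> X}) (toY : {action gT &-> Y}) (m : nat) :
  (0 < m)%N -> quasi_isomorphic toX toY m -> #|X| = #|Y|.
Proof.
move=> m_gt0 qiso; have [q m_lt_q q_pr] := prime_above m.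
have pcharq := pchar_Fp q_pr.
have m_neq0 : m%:R != 0 :> 'F_q by rewrite -(dvdn_pcharf pcharq) gtnNdvd.
have := module_iso_card_fix (quasi_iso_module_iso m_neq0 qiso) pcharq (pgroup1 gT q).
suff fix1 (Z : finType) (toZ : {action gT &-> Z}) : ('Fix_toZ(1))%g = setT.
  by rewrite /= !fix1 !cardsT.
by apply/setP=> z; rewrite in_setT; apply/afixP => g /set1P->; apply: act1.
Qed.

Section ProductAction.

Variables (gT1 gT2 : finGroupType) (X1 X2 : finType).
Variables (to1 : {action gT1 &-> X1}) (to2 : {action gT2 &-> X2}).

Definition prod_act (x : X1 * X2) (g : gT1 * gT2) : X1 * X2 := (to1 x.1 g.1, to2 x.2 g.2).

Lemma prod_act1 : prod_act^~ 1%g =1 id.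
Proof. by case=> x y; rewrite /prod_act !act1. Qed.

Lemma prod_actM x : act_morph prod_act x.
Proof. by move=> g h; rewrite /prod_act !actM. Qed.

Definition prod_action := TotalAction prod_act1 prod_actM.

Lemma prod_action_transitive :
  [transitive [set: gT1], on setT | to1] -> [transitive [set: gT2], on setT | to2] ->
  [transitive [set: gT1 * gT2], on setT | prod_action].
Proof.
move=> /imsetP[x1 _ orb1] /imsetP[x2 _ orb2].
apply/imsetP; exists (x1, x2) => //; apply/setP=> -[y1 y2]; rewrite inE; apply/esym.
have /orbitP[g1 _ <-] : y1 \in orbit to1 setT x1 by rewrite -orb1.
have /orbitP[g2 _ <-] : y2 \in orbit to2 setT x2 by rewrite -orb2.
by apply/orbitP; exists (g1, g2).
Qed.

Lemma fix_prod_left (Q : {group gT1}) :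
  ('Fix_prod_action(pairg1 gT2 @* Q))%g = setX ('Fix_to1(Q))%g setT.
Proof.
apply/setP=> -[x1 x2]; rewrite in_setX in_setT andbT.
apply/afixP/afixP => [fix_x q Qq|fix_x q].
  by have /(congr1 fst) := fix_x _ (mem_morphim (pairg1 gT2) (in_setT q) Qq).
by case/morphimP=> q1 _ /fix_x x1q ->; rewrite /= /prod_act /= x1q act1.
Qed.

Lemma fix_prod_right (Q : {group gT2}) :
  ('Fix_prod_action(@pair1g gT1 gT2 @* Q))%g = setX setT ('Fix_to2(Q))%g.
Proof.
apply/setP=> -[x1 x2]; rewrite in_setX in_setT; apply/afixP/afixP => [fix_x q Qq|fix_x q].
  by have /(congr1 snd) := fix_x _ (mem_morphim (@pair1g gT1 gT2) (in_setT q) Qq).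
by case/morphimP=> q2 _ /fix_x x2q ->; rewrite /= /prod_act /= x2q act1.
Qed.

End ProductAction.

(** These are Kronecker products, which multiply factor by factor. *)
Lemma inverse_upto_prod (X1 Y1 X2 Y2 : finType) (m1 m2 : nat)
    (M1 : X1 -> Y1 -> int) (N1 : Y1 -> X1 -> int)
    (M2 : X2 -> Y2 -> int) (N2 : Y2 -> X2 -> int) :
  inverse_upto m1 M1 N1 -> inverse_upto m2 M2 N2 ->
  inverse_upto (m1 * m2) (fun x y => M1 x.1 y.1 * M2 x.2 y.2)
    (fun y x => N1 y.1 x.1 * N2 y.2 x.2).
Proof.
move=> MN1 MN2 [x1 x2] [x1' x2'] /=.
transitivity (\sum_y1 \sum_y2 (M1 x1 y1 * N1 y1 x1') * (M2 x2 y2 * N2 y2 x2')).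
  by rewrite pair_bigA /=; apply: eq_bigr => y _; rewrite mulrACA.
under eq_bigr do rewrite -mulr_sumr MN2.
rewrite -mulr_suml MN1 natrM xpair_eqE.
by case: (x1 == x1'); case: (x2 == x2'); rewrite /= ?(mulr1n, mulr0n, mulr0, mul0r).
Qed.

Lemma quasi_isomorphic_prod (gT1 gT2 : finGroupType) (X1 Y1 X2 Y2 : finType)
    (toX1 : {action gT1 &-> X1}) (toY1 : {action gT1 &-> Y1})
    (toX2 : {action gT2 &-> X2}) (toY2 : {action gT2 &-> Y2}) (m1 m2 : nat) :
  quasi_isomorphic toX1 toY1 m1 -> quasi_isomorphic toX2 toY2 m2 ->
  quasi_isomorphic (prod_action toX1 toX2) (prod_action toY1 toY2) (m1 * m2).
Proof.
move=> [M1 [N1 [eqM1 eqN1 MN1 NM1]]] [M2 [N2 [eqM2 eqN2 MN2 NM2]]].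
exists (fun x y => M1 x.1 y.1 * M2 x.2 y.2), (fun y x => N1 y.1 x.1 * N2 y.2 x.2).
split; [ | | exact: inverse_upto_prod | exact: inverse_upto_prod].
  by move=> g x y; rewrite /= eqM1 eqM2.
by move=> g x y; rewrite /= eqN1 eqN2.
Qed.

(** For p in [P1], the subgroup Q x 1 fixes X1^Q x X2 and Y1^Q x Y2. Since |X2| = |Y2| is positive,
    the inequality of the first factors survives; p in [P2] is symmetric. *)
Lemma distinguishes_prod (P1 P2 : seq nat) (gT1 gT2 : finGroupType)
    (X1 Y1 X2 Y2 : finType)
    (toX1 : {action gT1 &-> X1}) (toY1 : {action gT1 &-> Y1})
    (toX2 : {action gT2 &-> X2}) (toY2 : {action gT2 &-> Y2}) :
  distinguishes P1 toX1 toY1 -> distinguishes P2 toX2 toY2 ->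
  distinguishes (P1 ++ P2) (prod_action toX1 toX2) (prod_action toY1 toY2).
Proof.
move=> [trX1 trY1 faith1 [m1 m1P qiso1] fix1] [trX2 trY2 faith2 [m2 m2P qiso2] fix2].
have X1_gt0 : (0 < #|X1|)%N by case/imsetP: trX1 => x _ _; apply/card_gt0P; exists x.
have X2_gt0 : (0 < #|X2|)%N by case/imsetP: trX2 => x _ _; apply/card_gt0P; exists x.
have {}card1 : #|X1| = #|Y1| by case/andP: m1P => m1_gt0 _; apply: quasi_iso_card qiso1.
have card2 : #|X2| = #|Y2| by case/andP: m2P => m2_gt0 _; apply: quasi_iso_card qiso2.
have [[x1 _] [x2 _]] := (card_gt0P X1_gt0, card_gt0P X2_gt0).
split.
- exact: prod_action_transitive.
- exact: prod_action_transitive.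
- move=> [g1 g2] fix_g; congr (_, _).
    by apply: faith1 => y1; have [] := fix_g (y1, x2).
  by apply: faith2 => y2; have [] := fix_g (x1, y2).
- exists (m1 * m2)%N; last exact: quasi_isomorphic_prod.
  rewrite pnatM; apply/andP; split.
    by apply: sub_in_pnat m1P => p _; rewrite !inE mem_cat => ->.
  by apply: sub_in_pnat m2P => p _; rewrite !inE mem_cat orbC => ->.
move=> p; rewrite mem_cat => /orP[/fix1|/fix2] [Q pQ neq].
  exists (pairg1 gT2 @* Q)%G; first exact: morphim_pgroup.
  by rewrite !fix_prod_left !cardsX !cardsT -card2 eqn_pmul2r.
exists (@pair1g gT1 gT2 @* Q)%G; first exact: morphim_pgroup.
by rewrite !fix_prod_right !cardsX !cardsT -card1 eqn_pmul2l.
Qed.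

Section TrivialAction.

Variable gT : finGroupType.

Definition unit_action : {action gT &-> unit} :=
  TotalAction (to := fun x _ => x) (fun _ => erefl) (fun _ _ _ => erefl).

Lemma distinguishes_unit : (forall g : gT, g = 1%g) ->
  distinguishes [::] unit_action unit_action.
Proof.
move=> gT_trivial.
have tr : [transitive [set: gT], on setT | unit_action].
  apply/imsetP; exists tt => //; apply/setP=> -[]; rewrite inE orbit_refl.
  by [].
split=> //; exists 1%N => //; exists (fun _ _ => 1), (fun _ _ => 1).
by split=> // -[] []; rewrite (big_pred1 tt) => [|[]]; rewrite ?mulr1 ?mulr1n.
Qed.

End TrivialAction.

Lemma distinguishes_exists (P : seq nat) : {in P, forall p, prime p} ->
  exists (gT : finGroupType) (X Y : finType) (toX : {action gT &-> X})
    (toY : {action gT &-> Y}), distinguishes P toX toY.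
Proof.
elim: P => [_|p P IH P_prime].
  exists {perm unit}, unit, unit, (unit_action _), (unit_action _).
  by apply: distinguishes_unit => s; apply/permP => -[]; rewrite perm1; case: (s tt).
have [|gT [X [Y [toX [toY dist]]]]] := IH.
  by move=> q Pq; apply: P_prime; rewrite inE Pq orbT.
have p_pr : prime p by apply: P_prime; rewrite mem_head.
by do 5 eexists; exact: distinguishes_prod (distinguishes_nzrow p_pr) dist.
Qed.

(** * Induction to a symmetric group *)

Section Transversal.

Variables (gT hT : finGroupType) (phi : {morphism [set: gT] >-> hT}).
Hypothesis phi_inj : ('injm phi)%g.
Local Open Scope group_scope.

(* The induced set is (right transversal of phi(gT)) * X, on which s acts through
   the decomposition r s = phi (coset_coef (r s)) (coset_repr (r s)). *)
Definition coset_repr (s : hT) : hT := repr ((phi @* setT) :* s).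

Definition coset_coef (s : hT) : gT := invm phi_inj (s * (coset_repr s)^-1).

Lemma coset_coefP s : phi (coset_coef s) * coset_repr s = s.
Proof.
rewrite invmK ?mulgKV // -mem_rcoset rcoset_sym.
exact: mem_repr_rcoset.
Qed.

Lemma coset_reprM g s : coset_repr (phi g * s) = coset_repr s.
Proof. by rewrite /coset_repr rcosetM rcoset_id // mem_morphim. Qed.

Lemma coset_coefM g s : coset_coef (phi g * s) = g * coset_coef s.
Proof.
apply: (injmP phi_inj); rewrite ?in_setT // morphM ?in_setT //.
apply: (mulIg (coset_repr s)).
by rewrite -{1}(coset_reprM g) coset_coefP -mulgA coset_coefP.
Qed.

Lemma coset_repr_id s : coset_repr (coset_repr s) == coset_repr s.
Proof. by rewrite -{2}(coset_coefP s) coset_reprM. Qed.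

Lemma coset_coef_repr r : coset_repr r == r -> coset_coef r = 1.
Proof.
move=> /eqP r_repr; apply: (injmP phi_inj); rewrite ?in_setT // morph1.
by apply: (mulIg r); rewrite mul1g -{2}r_repr coset_coefP.
Qed.

Definition transversal_type : Type := {r : hT | coset_repr r == r}.

HB.instance Definition _ := SubFinite.on transversal_type.

Implicit Types r : transversal_type.

Definition transversal_act r s : transversal_type :=
  exist _ (coset_repr (val r * s)) (coset_repr_id _).

Lemma transversal_act1 : transversal_act^~ 1 =1 id.
Proof. by move=> r; apply: val_inj; rewrite /= mulg1; apply/eqP/(valP r). Qed.

Lemma transversal_actM r : act_morph transversal_act r.
Proof.
move=> s t; apply: val_inj.
by rewrite /= mulgA -{1}(coset_coefP (val r * s)) -mulgA coset_reprM.
Qed.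

Definition transversal_action := TotalAction transversal_act1 transversal_actM.

(** Over a fixed coset, [s] thus acts on the fibre through its conjugate by the inverse of [r],
    which lies in the image of [phi]. *)
Lemma transversal_fix_coef r s : transversal_action r s = r ->
  phi (coset_coef (val r * s)) = val r * s * (val r)^-1.
Proof.
move=> /(congr1 val) /= fix_r; rewrite -[in RHS](coset_coefP (val r * s)) fix_r.
by rewrite mulgK.
Qed.

Definition transversal_base : transversal_type :=
  exist _ (coset_repr 1) (coset_repr_id _).

(** The trivial coset is stable under the image of [phi]. This makes the set of fixed cosets
    nonempty, so that its size can be cancelled later. *)
Lemma fix_transversal_base (Q : {group gT}) :
  transversal_base \in 'Fix_transversal_action(phi @* Q).
Proof.
(* The chosen representative of the trivial coset need not be 1, but it lies in the image of
   [phi]. *)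
have baseE : coset_repr 1 = phi (coset_coef 1)^-1.
  apply: (mulgI (phi (coset_coef 1))); rewrite coset_coefP.
  by rewrite -morphM ?in_setT // mulgV morph1.
apply/afixP => _ /morphimP[q _ _ ->]; apply: val_inj => /=.
by rewrite {1}baseE -morphM ?in_setT // -[phi _]mulg1 coset_reprM.
Qed.

Section Induced.

Variables (X : finType) (toX : {action gT &-> X}).

Definition induced_act (u : transversal_type * X) (s : hT) : transversal_type * X :=
  (transversal_act u.1 s, toX u.2 (coset_coef (val u.1 * s))).

Lemma induced_act1 : induced_act^~ 1 =1 id.
Proof.
move=> [r x]; rewrite /induced_act transversal_act1 /= mulg1.
by rewrite coset_coef_repr ?act1 ?(valP r).
Qed.

Lemma induced_actM u : act_morph induced_act u.
Proof.
move=> s t; rewrite /induced_act transversal_actM /= -actM; congr (_, toX _ _).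
by rewrite mulgA -{1}(coset_coefP (val u.1 * s)) -mulgA coset_coefM.
Qed.

Definition induced_action := TotalAction induced_act1 induced_actM.

Lemma induced_transitive : [transitive [set: gT], on setT | toX] ->
  [transitive [set: hT], on setT | induced_action].
Proof.
move=> /imsetP[x0 _ orb].
pose r0 := transversal_base; apply/imsetP; exists (r0, x0) => //.
apply/setP=> -[r x]; rewrite inE; apply/esym.
have /orbitP[g _ <-] : x \in orbit toX setT x0 by rewrite -orb.
(* Multiplying [r0] by this element gives phi g * r, with representative [r] and coefficient [g]. *)
apply/orbitP; exists ((val r0)^-1 * (phi g * val r)) => //.
rewrite /= /induced_act /= mulKVg coset_coefM coset_coef_repr ?(valP r) // mulg1.
congr (_, _); apply: val_inj; rewrite /= mulKVg coset_reprM.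
exact/eqP/(valP r).
Qed.

Lemma card_fix_induced (Q : {set hT}) :
  #|'Fix_induced_action(Q)| = (\sum_(r in 'Fix_transversal_action(Q))
     #|'Fix_toX([set coset_coef (val r * q) | q in Q])|)%N.
Proof.
rewrite -sum1_card.
under [RHS]eq_bigr do rewrite -sum1_card.
rewrite pair_big_dep /=; apply: eq_bigl => -[r x] /=.
apply/afixP/andP => [fix_u | [/afixP fix_r /afixP fix_x] q Qq].
  split; apply/afixP => q; first by move/fix_u/(congr1 fst).
  by case/imsetP=> s Qs ->; have /(congr1 snd) := fix_u s Qs.
by congr (_, _); [apply: fix_r | apply: fix_x; apply: imset_f].
Qed.

End Induced.

End Transversal.

(** The induced matrices are block diagonal, with one copy of the given matrix per coset. They are
    equivariant because points over the same coset are moved by the same coefficient. *)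
Lemma quasi_isomorphic_induced (gT hT : finGroupType)
    (phi : {morphism [set: gT] >-> hT}) (phi_inj : ('injm phi)%g) (X Y : finType)
    (toX : {action gT &-> X}) (toY : {action gT &-> Y}) (m : nat) :
  quasi_isomorphic toX toY m ->
  quasi_isomorphic (induced_action phi_inj toX) (induced_action phi_inj toY) m.
Proof.
move=> [M [N [eqM eqN MN NM]]].
pose I (Z W : finType) (L : Z -> W -> int) (u : transversal_type phi * Z)
  (v : transversal_type phi * W) : int := (u.1 == v.1)%:R * L u.2 v.2.
have eqI (Z W : finType) (toZ : {action gT &-> Z}) (toW : {action gT &-> W}) L :
    equivariant toZ toW L ->
    equivariant (induced_action phi_inj toZ) (induced_action phi_inj toW) (@I Z W L).
  move=> eqL s [r z] [r' w]; rewrite /I /=.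
  rewrite -[X in (X == _)]/(transversal_action phi_inj r s).
  rewrite -[X in (_ == X)]/(transversal_action phi_inj r' s) (inj_eq (act_inj _ s)).
  by case: eqP => [->|_]; rewrite ?eqL ?mul0r.
have invI (Z W : finType) (L : Z -> W -> int) (L' : W -> Z -> int) :
    inverse_upto m L L' -> inverse_upto m (@I Z W L) (@I W Z L').
  move=> LL' [r z] [r' z'] /=.
  transitivity (\sum_(c : transversal_type phi) \sum_w
      ((r == c)%:R * (c == r')%:R) * (L z w * L' w z')).
    by rewrite pair_bigA /=; apply: eq_bigr => -[c w] _; rewrite /I /= mulrACA.
  rewrite (bigD1 r) //= [X in _ + X]big1 ?addr0 => [|c neq]; last first.
    by rewrite big1 // => w _; rewrite eq_sym (negPf neq) !mul0r.
  rewrite -mulr_sumr LL' eqxx mul1r xpair_eqE.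
  by case: (r == r'); rewrite ?mul1r ?mul0r.
by exists (I X Y M), (I Y X N); split; [exact: eqI|exact: eqI|exact: invI|exact: invI].
Qed.

(** * The auxiliary set W and its embedding into a symmetric group *)

Section SumAction.

Variables (gT : finGroupType) (X Y : finType) (c : nat).
Variables (toX : {action gT &-> X}) (toY : {action gT &-> Y}).

Definition sum_act (w : X * 'I_c + Y) (g : gT) : X * 'I_c + Y :=
  match w with inl u => inl (toX u.1 g, u.2) | inr y => inr (toY y g) end.

Lemma sum_act1 : sum_act^~ 1%g =1 id.
Proof. by case=> [[x i]|y]; rewrite /= act1. Qed.

Lemma sum_actM w : act_morph sum_act w.
Proof. by case: w => [[x i]|y] g h; rewrite /= actM. Qed.

Definition sum_action := TotalAction sum_act1 sum_actM.

Lemma card_fix_sum (A : {set gT}) :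
  #|('Fix_sum_action(A))%g| = (#|('Fix_toX(A))%g| * c + #|('Fix_toY(A))%g|)%N.
Proof.
rewrite -sum1_card big_mkcond big_sumType /=; congr (_ + _)%N; rewrite -big_mkcond /=.
  rewrite -[in RHS](card_ord c) -(cardsT 'I_c) -cardsX -sum1_card.
  apply: eq_bigl => -[x i]; rewrite in_setX in_setT andbT.
  apply/afixP/afixP => fix_w g Ag; first by have [] := fix_w g Ag.
  by rewrite /= /sum_act /= fix_w.
rewrite -sum1_card; apply: eq_bigl => y.
apply/afixP/afixP => fix_w g Ag; first by have [] := fix_w g Ag.
by rewrite /= /sum_act /= fix_w.
Qed.

End SumAction.

Section OrdinalAction.

Variables (gT : finGroupType) (W : finType) (toW : {action gT &-> W}).

(** The action is transported along [enum_rank] because 'S_n consists of permutations of 'I_n. *)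
Definition ord_act (i : 'I_#|W|) (g : gT) : 'I_#|W| := enum_rank (toW (enum_val i) g).

Lemma ord_act1 : ord_act^~ 1%g =1 id.
Proof. by move=> i; rewrite /ord_act act1 enum_valK. Qed.

Lemma ord_actM i : act_morph ord_act i.
Proof. by move=> g h; rewrite /ord_act enum_rankK actM. Qed.

Definition ord_action := TotalAction ord_act1 ord_actM.

Lemma card_fix_ord (A : {set gT}) : #|('Fix_ord_action(A))%g| = #|('Fix_toW(A))%g|.
Proof.
rewrite -(card_imset _ enum_val_inj); apply: eq_card => w.
apply/imsetP/afixP => [[i /afixP fix_i ->] g Ag | fix_w].
  by apply: enum_rank_inj; rewrite -{2}(fix_i g Ag) enum_valK.
exists (enum_rank w); last by rewrite enum_rankK.
by apply/afixP => g Ag; rewrite /= /ord_act enum_rankK fix_w.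
Qed.

(* As r fixes the coset, the set on the left is the preimage in gT of the
   conjugate of the image of Q by r^-1. *)
Lemma card_fix_conj (inj : ('injm (actperm ord_action))%g) (Q : {group gT})
    (r : transversal_type (actperm ord_action)) :
  r \in ('Fix_(transversal_action inj)(actperm ord_action @* Q))%g ->
  #|('Fix_toW([set coset_coef inj (val r * q)%g | q in actperm ord_action @* Q]))%g|
    = #|('Fix_toW(Q))%g|.
Proof.
move=> /afixP fix_r; rewrite -!card_fix_ord.
(* The permutation [r] maps the points fixed by the conjugate of [Q] bijectively onto those fixed by
   [Q]. *)
rewrite -(card_imset _ (@perm_inj _ (val r))); apply: eq_card => i.
have actE g j : ord_action j g = actperm ord_action g j by rewrite actpermE.
apply/imsetP/afixP => [[j /afixP fix_j ->] g Qg | fix_i].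
  have Qg' := mem_morphim (actperm_morphism ord_action) (in_setT g) Qg.
  have := fix_j _ (imset_f _ Qg'); rewrite !actE transversal_fix_coef ?fix_r //.
  by rewrite !permM => /(canRL (permKV _)).
exists ((val r)^-1%g i); last by rewrite permKV.
apply/afixP => _ /imsetP[q Qq ->]; rewrite actE transversal_fix_coef ?fix_r //.
case/morphimP: Qq => g _ Qg ->.
by rewrite !permM permKV -actE fix_i.
Qed.

End OrdinalAction.

(** Uniqueness of quotient and remainder; it recovers |X^Q| and |Y^Q| from |W^Q| = |X^Q| c +
    |Y^Q|. *)
Lemma divmod_inj (c a b a' b' : nat) : (b < c)%N -> (b' < c)%N ->
  (a * c + b = a' * c + b')%N -> a = a' /\ b = b'.
Proof.
move=> b_lt b'_lt eq_abc; have := edivn_eq a b_lt.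
by rewrite eq_abc edivn_eq // => -[-> ->].
Qed.

(** * Comparison of the sets induced to the symmetric group *)

Theorem theorem5p4 (P : seq nat) (P_prime : forall p : nat, p \in P -> prime p) :
  exists n : nat, (0 < n)%N /\
  exists (X Y : finType)
         (toX : {action 'S_n &-> X}) (toY : {action 'S_n &-> Y}),
    [transitive [set: 'S_n], on [set: X] | toX] /\
    [transitive [set: 'S_n], on [set: Y] | toY] /\
    forall k : fieldType,
      module_isomorphic (perm_module k toX) (perm_module k toY) <->
      (forall p : nat, p \in P -> p \notin [pchar k]%R).
Proof.
have [gT [X [Y [toX [toY dist]]]]] := distinguishes_exists P_prime.
have [trX trY faithX [m mP qiso] fixP] := dist.
have [x0 _ _] := imsetP trX.
(* With |Y| + 1 copies of [X], the number |Y^Q|, being at most |Y|, is a genuine remainder. *)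
pose toW := sum_action #|Y|.+1 toX toY; pose phi := actperm_morphism (ord_action toW).
have phi_inj : ('injm phi)%g.
  apply/injmP => g h _ _ eq_gh.
  suff : (g * h^-1 = 1)%g by move/(canRL (mulgKV _)); rewrite mul1g.
  apply: faithX => x; rewrite actM; apply: (canLR (actK toX h)).
  have /permP/(_ (enum_rank (inl (x, ord0)))) := eq_gh.
  by rewrite !actpermE => /enum_rank_inj; rewrite enum_rankK => -[].
exists #|{: X * 'I_#|Y|.+1 + Y}|; split.
  by apply/card_gt0P; exists (inl (x0, ord0)).
exists _, _, (induced_action phi_inj toX), (induced_action phi_inj toY).
split; first exact: induced_transitive.
split; first exact: induced_transitive.
move=> k; split=> [iso p Pp | P'k].
  apply/negP=> pchark; have [Q pQ /eqP[]] := fixP p Pp.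
  have := module_iso_card_fix iso pchark (morphim_pgroup phi pQ).
  have fix_conj r : r \in ('Fix_(transversal_action phi_inj)(phi @* Q))%g ->
      let Qr := [set coset_coef phi_inj (val r * q)%g | q in (phi @* Q)%g] in
      #|('Fix_toX(Qr))%g| = #|('Fix_toX(Q))%g| /\
      #|('Fix_toY(Qr))%g| = #|('Fix_toY(Q))%g|.
    move=> fix_r Qr; have := card_fix_conj fix_r; rewrite !card_fix_sum.
    by apply: divmod_inj; rewrite ltnS max_card.
  (* All summands on the left equal |X^Q| and all on the right |Y^Q|. Both sums run over the same
     nonempty set of fixed cosets, so |X^Q| = |Y^Q|, a contradiction. *)
  rewrite !card_fix_induced.
  under eq_bigr => r /fix_conj[-> _] do [].
  under [RHS]eq_bigr => r /fix_conj[_ ->] do [].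
  rewrite !sum_nat_const => /eqP; rewrite eqn_pmul2l => [/eqP//|].
  apply/card_gt0P; exists (transversal_base phi_inj).
  exact: fix_transversal_base.
apply: quasi_iso_module_iso (quasi_isomorphic_induced phi_inj qiso).
(* If [m] vanished in [k], the characteristic would be a prime divisor of [m], hence a member of
   [P]. *)
case/andP: (mP) => m_gt0 _; apply/negP => m_eq0.
have [p pchark] := natf0_pchar m_gt0 m_eq0.
move: m_eq0; rewrite -(dvdn_pcharf pchark) => p_dvd_m.
have /P'k : p \in P.
  by have := pnatPpi mP; apply; rewrite mem_primes (pcharf_prime pchark) m_gt0.
by rewrite pchark.
Qed.
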